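(* Let $\mathbb{K}$ be a field of characteristic $0$ and $(\lambda,\mu)\in\mathrm{BP}_n$. Then $$V_{(\lambda,\mu)}=\Big(\bigcup_{(\vartheta,\omega)\in\mathrm{BP}_n,\ (\vartheta,\omega)\unlhd(\lambda,\mu)}H_{(\vartheta,\omega)}\Big)^c=\bigcup_{(\vartheta,\omega)\in\mathrm{BP}_n,\ (\vartheta,\omega)\not\unlhd(\lambda,\mu)}H_{(\vartheta,\omega)},$$ where $^c$ denotes the complement in $\mathbb{K}^n$.
   Context: Partitions, bipartitions, $\mathrm{BP}_n$ (set of bipartitions of $n$): a partition of $n$ is a non-increasing sequence of non-negative integers summing to $n$ (entries beyond its length are $0$); a bipartition is a pair $(\lambda,\mu)$ of partitions with $|\lambda|+|\mu|=n$. Bitableau of shape $(\lambda,\mu)$: filling of the pair of Young diagrams of shapes $\lambda,\mu$ with $1,\dots,n$, each once. With $\Delta_{(i_1,\dots,i_m)}(\mathbf{y})=\prod_{j<k}(y_{i_j}-y_{i_k})$, the Specht polynomial of a bitableau $(T,S)$ is $\mathrm{sp}_{(T,S)}(\mathbf{x})=\prod_i\Delta_{T_i}(\mathbf{x}^2)\prod_j\Delta_{S_j}(\mathbf{x}^2)\prod_{k\in S}x_k$, with $T_i,S_j$ the columns read top to bottom and $\mathbf{x}^2=(x_1^2,\dots,x_n^2)$. $V_{(\lambda,\mu)}\subset\mathbb{K}^n$ is the common zero set of all $\mathrm{sp}_{(T,S)}$ with $(T,S)$ of shape $(\lambda,\mu)$. Bidominance: $(\vartheta,\omega)\unlhd(\lambda,\mu)$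 iff for all $k\ge1$, $\sum_{j\le k}(\vartheta_j+\omega_j)\le\sum_{j\le k}(\lambda_j+\mu_j)$ and $\sum_{j\le k-1}(\vartheta_j+\omega_j)+\vartheta_k\le\sum_{j\le k-1}(\lambda_j+\mu_j)+\lambda_k$. Orbit types: for $y\in\mathbb{K}^n$, $\Lambda(y)$ is the partition of $n$ listing, in non-increasing order, the multiplicities of the distinct values among the coordinates of $y$. For a partition $\lambda=(\lambda_1,\dots,\lambda_m)$ and $t\in\mathbb{Z}_{\ge0}$, let $j=\min\{i:\lambda_i<t\}$ ($j=m+1$ if $t=0$); the $t$-cut is $\mathrm{cut}(\lambda,t)=(\rho,\sigma)$ with $\rho=(t,\dots,t,\lambda_j,\dots,\lambda_m)$ ($j-1$ copies of $t$, zero entries dropped) and $\sigma=(\lambda_1-t,\dots,\lambda_{j-1}-t)$. For $z\in\mathbb{K}^n$ with $t_z$ zero coordinates, $\Omega(z)=\mathrm{cut}(\Lambda(z^2),t_z)$ where $z^2=(z_1^2,\dots,z_n^2)$, and for $(\lambda,\mu)\in\mathrm{BP}_n$, $H_{(\lambda,\mu)}=\{z\in\mathbb{K}^n:\Omega(z)=(\lambda,\mu)\}$. *)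

(* Defs.v *)
From mathcomp Require Import all_boot all_order all_algebra.
From mathcomp Require Import boolp classical_sets.
From mathcomp Require Import mpoly.

Set Implicit Arguments.
Unset Strict Implicit.
Unset Printing Implicit Defensive.

Import GRing.Theory.

Local Open Scope ring_scope.

(* Partitions are represented canonically, by the sequence of their positive
   parts, so that equality of partitions is Leibniz equality of sequences.
   Parts are indexed from 0: lambda_(j+1) is [nth 0 lambda j]. *)
Definition is_partition (s : seq nat) : bool :=
  sorted geq s && (0%N \notin s).

Definition BP (n : nat) : set (seq nat * seq nat) :=
  [set b | [/\ is_partition b.1, is_partition b.2
             & (sumn b.1 + sumn b.2 = n)%N]].

(* The index k is shifted: [k] here is k - 1 in the usual convention k >= 1. *)
Definition bidominated (a b : seq nat * seq nat) : Prop :=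
  forall k : nat,
    (\sum_(j < k.+1) (nth 0 a.1 j + nth 0 a.2 j)
       <= \sum_(j < k.+1) (nth 0 b.1 j + nth 0 b.2 j))%N
    /\ (\sum_(j < k) (nth 0 a.1 j + nth 0 a.2 j) + nth 0 a.1 k
       <= \sum_(j < k) (nth 0 b.1 j + nth 0 b.2 j) + nth 0 b.1 k)%N.

(* A filling is given by its list of rows; the entries are the elements
   0, ..., n-1 of 'I_n, standing for 1, ..., n. *)
Definition is_bitableau (n : nat) (b : seq nat * seq nat)
    (T S : seq (seq 'I_n)) : Prop :=
  [/\ shape T = b.1, shape S = b.2
    & perm_eq (flatten T ++ flatten S) (enum 'I_n)].

(* The [j]-th column (from 0), read top to bottom; rows that are too short
   contribute no entry. *)
Definition column (A : Type) (T : seq (seq A)) (j : nat) : seq A :=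
  pmap (fun row => onth row j) T.

(* The first row is the longest one. *)
Definition ncolumns (A : Type) (T : seq (seq A)) : nat := size (head [::] T).

Definition Delta (n : nat) (R : comNzRingType) (s : seq 'I_n)
    (y : 'I_n -> R) : R :=
  \prod_(j < size s) \prod_(k < size s | (j < k)%N)
    (y (tnth (in_tuple s) j) - y (tnth (in_tuple s) k)).

Definition specht (n : nat) (K : fieldType) (T S : seq (seq 'I_n)) :
    {mpoly K[n]} :=
  (\prod_(i < ncolumns T) Delta (column T i) (fun k => 'X_k ^+ 2))
  * (\prod_(j < ncolumns S) Delta (column S j) (fun k => 'X_k ^+ 2))
  * \prod_(k <- flatten S) 'X_k.

Definition specht_variety (n : nat) (K : fieldType) (b : seq nat * seq nat) :
    set 'rV[K]_n :=
  [set z | forall T S : seq (seq 'I_n),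
     is_bitableau b T S -> (specht K T S).@[fun i => z 0 i] = 0].

Definition orbit_type (n : nat) (K : fieldType) (y : 'rV[K]_n) : seq nat :=
  let ys := [seq y 0 i | i <- enum 'I_n] in
  sort geq [seq count_mem a ys | a <- undup ys].

(* [find] returns the number j - 1 of leading parts that are at least [t];
   zero entries are dropped to keep both components canonical. *)
Definition cut (s : seq nat) (t : nat) : seq nat * seq nat :=
  let j := find (fun p => p < t)%N s in
  ([seq p <- nseq j t ++ drop j s | (0 < p)%N],
   [seq p <- [seq (p - t)%N | p <- take j s] | (0 < p)%N]).

Definition Omega (n : nat) (K : fieldType) (z : 'rV[K]_n) : seq nat * seq nat :=
  cut (orbit_type (map_mx (fun a => a ^+ 2) z)) #|[set i | z 0 i == 0]|.

Definition orbit_set (n : nat) (K : fieldType) (b : seq nat * seq nat) :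
    set 'rV[K]_n :=
  [set z | Omega z = b].

Arguments specht_variety n K b : clear implicits.
Arguments orbit_set n K b : clear implicits.

(* Main.v *)
(* A Specht polynomial does not vanish at [z] iff the values of [z^2] are pairwise
   distinct along every column of the bitableau and nonzero on its second part.
   So [z] lies outside the variety iff the boxes of [lm] can be filled with the
   values of [z^2], with the right multiplicities, in this way.  Giving each value
   a set of columns turns this into a Gale-Ryser problem in which the value [0] is
   only allowed in columns of the first diagram.  By a greedy construction it is
   solvable iff any [k] nonzero values have at most
   [sum_(j < k) (lambda_j + mu_j)] occurrences, and together with the value [0]
   at most [sum_(j < k) (lambda_j + mu_j) + lambda_k].
   Since [cut L t] has parts [min(L_j, t)] and [L_j - t], taking the most frequent
   values shows that these are exactly the inequalities of [bidominated]. *)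

Require Import Defs.
From mathcomp Require Import all_boot all_order all_algebra.
From mathcomp Require Import boolp classical_sets.
From mathcomp Require Import mpoly zify.

Set Implicit Arguments.
Unset Strict Implicit.
Unset Printing Implicit Defensive.

(** * Partitions, conjugates and cuts *)

(** In a non-increasing sequence the entries above [c] form an initial segment. For a partition,
    [count (ltn c) s] is the height of column [c], columns being numbered from 0. *)
Lemma nth_gt_count s c r :
  sorted geq s -> (c < nth 0 s r) = (r < count (ltn c) s).
Proof.
elim: s r => [|x s IHs] r /= hs; first by rewrite nth_nil !ltn0.
have count0 : x <= c -> count (ltn c) s = 0.
  move=> xc; apply/eqP; rewrite -leqn0 leqNgt -has_count; apply/hasPn => y ys.
  have /allP/(_ y ys) := order_path_min (rev_trans leq_trans) hs.
  by rewrite /= -leqNgt => /leq_trans; apply.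
case: r => [|r] /=; case: (ltnP c x) => cx //=.
- by rewrite count0.
- by rewrite IHs ?(path_sorted hs) // add1n ltnS.
- by rewrite IHs ?(path_sorted hs) // count0.
Qed.

Lemma nth_geq_le s i j : sorted geq s -> i <= j -> nth 0 s j <= nth 0 s i.
Proof.
move=> hs ij; rewrite leqNgt nth_gt_count // -leqNgt.
by apply: leq_trans ij; rewrite leqNgt -nth_gt_count // ltnn.
Qed.

Lemma nth_le_sumn s j : nth 0 s j <= sumn s.
Proof.
elim: s j => [|x s IHs] [|j] //=; first exact: leq_addr.
exact: leq_trans (IHs j) (leq_addl _ _).
Qed.

Lemma sum_ltn_ord N x : \sum_(c < N) (c < x : nat) = minn N x.
Proof. by elim: N => [|N IHN]; rewrite ?big_ord0 ?big_ord_recr /= ?IHN; lia. Qed.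

(* Both sides count the boxes lying in the first [k] rows. *)
Lemma sum_minn_conjugate s N k : sorted geq s -> sumn s <= N ->
  \sum_(c < N) minn (count (ltn c) s) k = \sum_(j < k) nth 0 s j.
Proof.
move=> hs sN; transitivity (\sum_(j < k) \sum_(c < N) (c < nth 0 s j : nat)).
  rewrite exchange_big /=; apply: eq_bigr => c _.
  under eq_bigr => j _ do rewrite nth_gt_count //.
  by rewrite sum_ltn_ord minnC.
apply: eq_bigr => j _; rewrite sum_ltn_ord; apply/minn_idPr.
exact: leq_trans (nth_le_sumn _ _) sN.
Qed.

Lemma sum_nth_sumn s : \sum_(j < size s) nth 0 s j = sumn s.
Proof. by rewrite sumnE (big_nth 0) big_mkord. Qed.

Lemma sum_conjugate s N : sorted geq s -> sumn s <= N ->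
  \sum_(c < N) count (ltn c) s = sumn s.
Proof.
move=> hs sN; rewrite -sum_nth_sumn -(sum_minn_conjugate _ hs sN).
by apply: eq_bigr => c _; rewrite (minn_idPl (count_size _ _)).
Qed.

(** The r-th entry of [s] occurs in [L] at position r or later, hence is at most [nth 0 L r]. *)
Lemma sumn_subseq_le L s : sorted geq L -> subseq s L ->
  sumn s <= \sum_(j < size s) nth 0 L j.
Proof.
elim: L s => [|x L IHL] [|y s] hL; rewrite /= ?big_ord0 //.
have hL' := path_sorted hL.
case: eqP => [-> sL | _ sL].
  by rewrite big_ord_recl /= leq_add2l IHL.
apply: leq_trans (IHL _ hL' sL) _; apply: leq_sum => j _.
exact: (nth_geq_le (s := x :: L) hL (leqnSn j)).
Qed.

Lemma is_partition_sumn0 s : is_partition s -> sumn s = 0 -> s = [::].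
Proof.
by case: s => //= x s /andP[_]; rewrite inE negb_or eq_sym; case: x.
Qed.

(** The index found in [cut] separates the parts at least [t] from the smaller ones, so the cut acts
    on each part separately. Truncated subtraction turns the smaller parts into zeros, which the
    filter drops. *)
Lemma cutE s t : sorted geq s ->
  cut s t = ([seq p <- [seq minn p t | p <- s] | 0 < p],
             [seq p <- [seq p - t | p <- s] | 0 < p]).
Proof.
move=> hs; rewrite /cut; set j := find _ _.
have -> : nseq j t ++ drop j s = [seq minn p t | p <- s].
  rewrite /j {j}; elim: s hs => //= x s IHs hs; case: ltnP => xt /=.
    congr cons; rewrite -[LHS]map_id; apply/eq_in_map => y ys /=.
    have /allP/(_ y ys) := order_path_min (rev_trans leq_trans) hs.
    by move=> /= yx; rewrite (minn_idPl (leq_trans yx (ltnW xt))).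
  by rewrite IHs // (path_sorted hs).
congr pair.
rewrite /j {j}; elim: s hs => //= x s IHs hs; case: ltnP => xt /=; last first.
  by rewrite IHs // (path_sorted hs).
rewrite subn_gt0 ltnNge (ltnW xt) /=.
suff /eq_in_filter -> : {in [seq p - t | p <- s], (fun p => 0 < p) =1 pred0}.
  by rewrite filter_pred0.
move=> _ /mapP[y ys ->] /=.
have /allP/(_ y ys) /= := order_path_min (rev_trans leq_trans) hs.
by lia.
Qed.

(** The zeros come last, so after filtering the default value of [nth] stands in for them. *)
Lemma nth_filter_gt0 s j : sorted geq s -> nth 0 [seq p <- s | 0 < p] j = nth 0 s j.
Proof.
elim: s j => //= x s IHs j hs; case: x hs => [|x] hs /=; last first.
  by case: j => //= j; rewrite IHs // (path_sorted hs).
rewrite IHs ?(path_sorted hs) //.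
have := nth_geq_le (s := 0 :: s) hs (leq0n j.+1).
by have := nth_geq_le (s := 0 :: s) hs (leq0n j) => /=; lia.
Qed.

Lemma sumn_filter_gt0 s : sumn [seq p <- s | 0 < p] = sumn s.
Proof. by elim: s => //= x s <-; case: x. Qed.

Lemma cut_nth s t j : sorted geq s ->
  nth 0 (cut s t).1 j = minn (nth 0 s j) t /\ nth 0 (cut s t).2 j = nth 0 s j - t.
Proof.
move=> hs; rewrite cutE //= !nth_filter_gt0.
- case: (ltnP j (size s)) => js; first by rewrite !(nth_map 0).
  by rewrite !nth_default ?size_map // min0n.
- by apply: homo_sorted hs => x y /=; lia.
- by apply: homo_sorted hs => x y /=; lia.
Qed.

Lemma cut_BP s t : sorted geq s -> BP (sumn s) (cut s t).
Proof.
move=> hs; rewrite cutE //; split => /=; rewrite ?/is_partition.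
- rewrite sorted_filter ?mem_filter ?andbT //; first exact: rev_trans leq_trans.
  by apply: homo_sorted hs => x y /=; lia.
- rewrite sorted_filter ?mem_filter ?andbT //; first exact: rev_trans leq_trans.
  by apply: homo_sorted hs => x y /=; lia.
by rewrite !sumn_filter_gt0; elim: s {hs} => //= x s; lia.
Qed.

(** * A Gale-Ryser theorem with one restricted value *)

(* Greedy step: a value of multiplicity [m], allowed in the columns [Z] only, is
   put in the [m] longest columns of [Z].  The surviving conditions of
   Gale-Ryser type follow from the alternative, for every [k]. *)
Lemma peel_columns (C : finType) (cap : C -> nat) (Z : {set C}) m :
  m <= \sum_c minn (cap c) (c \in Z) ->
  exists X : {set C}, [/\ X \subset Z, #|X| = m,
    forall c, (c \in X : nat) <= cap c,
    m + \sum_c (cap c - (c \in X)) = \sum_c cap c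
    & forall k, let cap' c := cap c - (c \in X) in
      \sum_c minn (cap' c) k = \sum_c minn (cap c) k
      \/ \sum_c minn (cap' c) k + m = \sum_c minn (cap c) (k + (c \in Z))].
Proof.
pose Z' := [set c in Z | 0 < cap c].
have -> : \sum_c minn (cap c) (c \in Z) = #|Z'|.
  rewrite -sum1_card [RHS]big_mkcond; apply: eq_bigr => c _.
  by rewrite inE; case: (c \in Z); rewrite ?minn0 //=; case: (cap c).
move=> mZ; pose le c c' := cap c' <= cap c.
have le_tr : transitive le by move=> x y z xy yz; exact: leq_trans yz xy.
have le_tot : total le by move=> x y; exact: leq_total.
pose s := sort le (enum Z').
have s_uniq : uniq s by rewrite sort_uniq enum_uniq.
have mem_s c : (c \in s) = (c \in Z') by rewrite mem_sort mem_enum.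
have := sort_sorted le_tot (enum Z').
rewrite -/s sorted_pairwise // -(cat_take_drop m s) pairwise_cat.
case/and3P => /allrelP top _ _.
pose X := [set c in take m s].
have XZ' c : c \in X -> c \in Z' by rewrite inE => /mem_take; rewrite mem_s.
have cardX : #|X| = m.
  rewrite cardsE; move/card_uniqP: (take_uniq m s_uniq) => ->.
  by rewrite size_takel // size_sort -cardE.
have topX c c' : c \in X -> c' \in Z -> c' \notin X -> cap c' <= cap c.
  move=> cX c'Z c'X; case: (posnP (cap c')) => [-> //|c'0].
  have : c' \in s by rewrite mem_s inE c'Z.
  rewrite -(cat_take_drop m s) mem_cat; move: c'X cX; rewrite !inE.
  by move=> /negPf -> /= cX; exact: top.
have X0 : {in X, forall c, 0 < cap c} by move=> c /XZ'; rewrite inE => /andP[].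
have X_le c : (c \in X : nat) <= cap c by case: (c \in X) (X0 c) => [/(_ isT)|].
exists X; split=> //.
- by apply/fintype.subsetP => c /XZ'; rewrite inE => /andP[].
- rewrite -cardX -sum1_card big_mkcond -big_split /=; apply: eq_bigr => c _.
  by have := X_le c; case: (c \in X) => /=; lia.
move=> k cap'.
(* If some chosen column has capacity at most [k], so has every unchosen column of [Z], and raising
   the truncation level from [k] to [k + 1] on [Z] gains exactly one unit per chosen column.
   Otherwise all chosen columns exceed [k], and losing one unit does not affect truncation at
   [k]. *)
have [/existsP[c0 /andP[c0X c0k]]|/existsPn noX] := boolP [exists c in X, cap c <= k].
  right; rewrite -cardX -sum1_card [X in _ + X]big_mkcond -big_split /=.
  apply: eq_bigr => c _; rewrite /cap'; case: (boolP (c \in X)) => cX.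
    have := X0 _ cX; have := XZ' _ cX; rewrite inE => /andP[-> _]; lia.
  rewrite subn0 addn0; case: (boolP (c \in Z)) => cZ; last by rewrite addn0.
  have := topX _ _ c0X cZ cX; lia.
left; apply: eq_bigr => c _; rewrite /cap'; have := noX c.
by case: (c \in X) => /=; lia.
Qed.

(** Induction on [vs]: once [v] is placed greedily, the next value takes its role with all columns
    allowed. Whichever alternative of [peel_columns] occurs, each new condition follows from one of
    the two old families. *)
Lemma gale_ryser_restricted (V : eqType) (C : finType) (m : V -> nat)
    (v : V) (vs : seq V) (cap : C -> nat) (Z : {set C}) :
  uniq (v :: vs) ->
  \sum_(u <- v :: vs) m u = \sum_c cap c ->
  (forall s, subseq s vs -> \sum_(u <- s) m u <= \sum_c minn (cap c) (size s)) ->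
  (forall s, subseq s vs ->
     m v + \sum_(u <- s) m u <= \sum_c minn (cap c) (size s + (c \in Z))) ->
  exists X : V -> {set C}, [/\ X v \subset Z, {in v :: vs, forall u, #|X u| = m u}
    & forall c, count (fun u => c \in X u) (v :: vs) = cap c].
Proof.
elim: vs v cap Z => [|v' vs IHvs] v cap Z uv tot cond condZ.
  have [|X0 [X0Z cardX0 X0_le tot0 _]] := @peel_columns C cap Z (m v).
    by have := condZ [::] isT; rewrite big_nil addn0.
  exists (fun=> X0); split=> //= [u|c]; first by rewrite inE => /eqP ->.
  (* The last value exhausts the total capacity, so no column keeps a remainder. *)
  rewrite addn0; have := X0_le c; move: tot; rewrite big_seq1 -tot0.
  move/eqP; rewrite -[X in X == _]addn0 eqn_add2l eq_sym sum_nat_eq0.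
  by move/forallP/(_ c)/eqP; lia.
have [|X0 [X0Z cardX0 X0_le tot0 sums]] := @peel_columns C cap Z (m v).
  by have := condZ [::] isT; rewrite big_nil addn0.
have [vvs uvs] := andP uv.
have [|||X [_ cardX countX]] :=
    IHvs v' (fun c => cap c - (c \in X0)) [set: C] uvs.
- by apply/eqP; rewrite -(eqn_add2l (m v)) tot0 -tot [in eqbRHS]big_cons.
- move=> s sv; have sv' := subseq_trans sv (subseq_cons vs v').
  case: (sums (size s)) => e; first by rewrite e cond.
  by rewrite -(leq_add2r (m v)) e addnC condZ.
- move=> s sv.
  have sv' : subseq (v' :: s) (v' :: vs) by rewrite /= eqxx.
  have := cond _ sv'; have := condZ _ sv'; rewrite big_cons /=.
  have -> : \sum_c minn (cap c - (c \in X0)) (size s + (c \in [set: C]))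
      = \sum_c minn (cap c - (c \in X0)) (size s).+1.
    by apply: eq_bigr => c _; rewrite inE addn1.
  by case: (sums (size s).+1) => /= e; lia.
exists (fun u => if u == v then X0 else X u); split; first by rewrite eqxx.
- move=> u; rewrite inE; case: eqP => [-> _ //|_ /=]; exact: cardX.
- move=> c; rewrite -(subnK (X0_le c)) -countX /= eqxx addnC; congr (_ + _).
  apply: (@eq_in_count _ _ _ (v' :: vs)) => u uin.
  by case: eqP => // uv'; rewrite -uv' uin in vvs.
Qed.

(** * Tableaux and their columns *)

Lemma mem_flatten_column (A : eqType) (T : seq (seq A)) x :
  (x \in flatten T) <-> exists c, x \in column T c.
Proof.
split=> [/flattenP[row Trow /onthP[c rowc]]|[c]]; last first.
  rewrite mem_pmap => /mapP[row Trow rowc]; apply/flattenP; exists row => //.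
  by apply/onthP; exists c.
by exists c; rewrite mem_pmap; apply/mapP; exists row.
Qed.

Lemma column_oversize (A : Type) (T : seq (seq A)) c :
  sorted geq (shape T) -> ncolumns T <= c -> column T c = [::].
Proof.
have short (T' : seq (seq A)) : all (fun row => size row <= c) T' -> column T' c = [::].
  elim: T' => //= row T' IHT /andP[rowc /IHT T'c].
  by rewrite /column /= onth_default.
rewrite /ncolumns; case: T => [|row T] hs le_c; apply: short => //=.
rewrite (le_c : size row <= c); have := order_path_min (rev_trans leq_trans) hs.
by rewrite all_map; apply: sub_all => r /= /leq_trans; apply.
Qed.

Lemma size_column (A : Type) (T : seq (seq A)) c :
  size (column T c) = count (ltn c) (shape T).
Proof.
by rewrite size_pmap count_map; apply: eq_count => row /=; rewrite onthTE.
Qed.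

Lemma sum_count_column (A : Type) (p : pred A) (T : seq (seq A)) N :
  all (fun row => size row <= N) T ->
  \sum_(c < N) count p (column T c) = count p (flatten T).
Proof.
elim: T => [_|row T IHT /= /andP[le_N hT]]; first by rewrite big1.
rewrite count_cat -IHT // -(subnKC le_N) /=.
(* The row is padded with empty positions up to length [N], so that every row is summed over the
   same range of columns. *)
have -> : count p row = \sum_(c < size row + (N - size row))
    (if onth row c is Some x then p x : nat else 0).
  rewrite big_split_ord /= [X in _ + X]big1 ?addn0; last first.
    by move=> c _; rewrite onth_default ?leq_addr.
  by elim: {le_N} row => [|x row IHrow]; rewrite ?big_ord0 ?big_ord_recl //= IHrow.
rewrite -big_split /=; apply: eq_bigr => c _.
by rewrite /column /=; case: (onth row c).
Qed.

Definition column_injective (A : Type) (V : eqType) (w : A -> V)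
    (T : seq (seq A)) : Prop :=
  forall c, uniq (map w (column T c)).

(** Row r collects the r-th entries of the columns [c < nth 0 s r]. By [nth_gt_count] these are
    exactly the columns of height above r, so the default [x0] is never read. *)
Lemma tableau_of_columns (A : Type) (x0 : A) s (cs : nat -> seq A) :
  sorted geq s -> (forall c, size (cs c) = count (ltn c) s) ->
  exists T, shape T = s /\ forall c, column T c = cs c.
Proof.
move=> hs size_cs.
pose T := [seq [seq nth x0 (cs c) r | c <- iota 0 (nth 0 s r)] | r <- iota 0 (size s)].
exists T; split=> [|c].
  rewrite /shape -map_comp -[RHS](mkseq_nth 0).
  by apply: eq_map => r /=; rewrite size_map size_iota.
transitivity [seq nth x0 (cs c) r | r <- iota 0 (size s) & c < nth 0 s r].
  rewrite /column /T; elim: (iota 0 (size s)) => //= r rs ->.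
  rewrite onth_map; case: ltnP => cr.
    by rewrite (_ : onth _ _ = Some c) // onthE (nth_map 0) ?size_iota // nth_iota.
  by rewrite onth_default // size_iota.
rewrite [RHS](_ : _ = mkseq (nth x0 (cs c)) (count (ltn c) s)); last first.
  by rewrite -size_cs mkseq_nth.
congr map; rewrite -(filter_iota_ltn 0 (count_size (ltn c) s)).
by apply: eq_filter => r; rewrite nth_gt_count.
Qed.

Lemma sum_count_mem (V : eqType) (A ys : seq V) : uniq A ->
  \sum_(v <- A) count_mem v ys = count (mem A) ys.
Proof.
move=> uA; elim: ys => [|y ys IHys] /=; first by rewrite big1.
rewrite big_split /= IHys; congr (_ + _).
rewrite -(count_uniq_mem y uA) -sum1_count [RHS]big_mkcond /=.
by apply: eq_bigr => v _; rewrite eq_sym; case: eqP.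
Qed.

(** A column carries each value of [B] at most once, so it has at most the minimum of its height and
    [k] boxes with values in [B]; these minima add up to the first [k] rows. *)
Lemma count_image_column (A : Type) (V : eqType) (w : A -> V) (T : seq (seq A))
    (B : seq V) k :
  sorted geq (shape T) -> column_injective w T -> size B <= k ->
  count (fun x => w x \in B) (flatten T) <= \sum_(j < k) nth 0 (shape T) j.
Proof.
move=> hs inj Bk; pose N := sumn (shape T).
rewrite -(@sum_count_column _ _ _ N); last first.
  apply/(all_nthP [::]) => r rT; apply: leq_trans (nth_le_sumn _ r).
  by rewrite (nth_map [::]).
rewrite -(sum_minn_conjugate _ hs (leqnn _)); apply: leq_sum => c _.
rewrite leq_min -size_column count_size /=; apply: leq_trans Bk.
rewrite -(count_map w (mem B)) -size_filter; apply: uniq_leq_size.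
  by rewrite filter_uniq.
by move=> v; rewrite mem_filter => /andP[].
Qed.

(** * Admissible fillings of a bipartition *)

(** For [w i] the square of the i-th coordinate and [v0 = 0], this is the nonvanishing of the Specht
    polynomial; see [specht_neq0]. *)
Definition admissible (n : nat) (V : eqType) (w : 'I_n -> V) (v0 : V)
    (lm : seq nat * seq nat) (T S : seq (seq 'I_n)) : Prop :=
  [/\ is_bitableau lm T S, column_injective w T, column_injective w S
    & all (fun i => w i != v0) (flatten S)].

(* Elements of a value class [v] are distributed over the columns in [X v]; the
   column [c] then consists of one element of every class with [c \in X v]. *)
Lemma fill_bitableau (n : nat) (V : eqType) (w : 'I_n -> V) (v0 : V)
    (lm : seq nat * seq nat) :
  let m v := count_mem v [seq w i | i <- enum 'I_n] in
  BP n lm ->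
  (forall s, uniq (v0 :: s) -> \sum_(v <- s) m v
     <= \sum_(j < size s) (nth 0 lm.1 j + nth 0 lm.2 j)) ->
  (forall s, uniq (v0 :: s) -> m v0 + \sum_(v <- s) m v
     <= \sum_(j < size s) (nth 0 lm.1 j + nth 0 lm.2 j) + nth 0 lm.1 (size s)) ->
  exists T S, admissible w v0 lm T S.
Proof.
move=> m [part1 part2 sum_n] cond1 cond2.
have [i0 _|noI] := pickP (@predT 'I_n); last first.
  have n0 : n = 0 by rewrite -(card_ord n) eq_card0.
  exists [::], [::]; split=> //; split.
  - by rewrite [lm.1]is_partition_sumn0 //; lia.
  - by rewrite [lm.2]is_partition_sumn0 //; lia.
  - rewrite (size0nil (s := enum _)) // size_enum_ord; exact: n0.
have [sorted1 _] := andP part1; have [sorted2 _] := andP part2.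
have sum1_n : sumn lm.1 <= n by rewrite -sum_n leq_addr.
have sum2_n : sumn lm.2 <= n by rewrite -sum_n leq_addl.
pose ys := [seq w i | i <- enum 'I_n].
(* [v0] will head the list of values even if it does not occur; its multiplicity is then 0. *)
pose vs := [seq v <- undup ys | v != v0].
have uniq_vs : uniq (v0 :: vs) by rewrite /= mem_filter eqxx filter_uniq ?undup_uniq.
have mem_vs i : w i \in v0 :: vs.
  rewrite inE mem_filter mem_undup map_f ?mem_enum // andbT; exact: orbN.
pose cap (p : bool * 'I_n) := count (ltn p.2) (if p.1 then lm.1 else lm.2).
have sum_pair F : \sum_(p : bool * 'I_n) F p
    = \sum_(c < n) F (true, c) + \sum_(c < n) F (false, c).
  transitivity (\sum_(b : bool) \sum_(c < n) F (b, c)); last by rewrite big_bool.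
  rewrite (pair_bigA _ (fun b c => F (b, c))) /=.
  by apply: eq_bigr => -[].
have sum_cap k : \sum_p minn (cap p) k = \sum_(j < k) (nth 0 lm.1 j + nth 0 lm.2 j).
  by rewrite sum_pair big_split /= /cap /= !sum_minn_conjugate.
pose Z := [set p : bool * 'I_n | p.1].
have sum_capZ k : \sum_p minn (cap p) (k + (p \in Z))
    = \sum_(j < k) (nth 0 lm.1 j + nth 0 lm.2 j) + nth 0 lm.1 k.
  rewrite sum_pair big_split /=.
  under eq_bigr => c _ do rewrite inE addn1.
  under [X in _ + X = _]eq_bigr => c _ do rewrite inE addn0.
  by rewrite /cap /= !sum_minn_conjugate // big_ord_recr addnAC.
have sub_vs s : subseq s vs -> uniq (v0 :: s).
  move=> svs; have svs' : subseq (v0 :: s) (v0 :: vs) by rewrite /= eqxx.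
  exact: subseq_uniq svs' uniq_vs.
have tot : \sum_(v <- v0 :: vs) m v = \sum_p cap p.
  rewrite sum_pair /cap /= !sum_conjugate // sum_n sum_count_mem //.
  rewrite count_map -[RHS](size_enum_ord n); apply/eqP; rewrite -all_count.
  by apply/allP => i _; exact: mem_vs.
have [s svs|s svs|X [XZ cardX countX]] :=
    @gale_ryser_restricted V _ m v0 vs cap Z uniq_vs tot.
- by rewrite sum_cap cond1 ?sub_vs.
- by rewrite sum_capZ cond2 ?sub_vs.
pose cls v := [seq i <- enum 'I_n | w i == v].
have size_cls v : size (cls v) = m v by rewrite size_filter /m count_map.
(* Since [X v] and the class of [v] have the same size, their enumerations match columns with
   elements. *)
pose elt v p := nth i0 (cls v) (index p (enum (X v))).
have w_elt v p : v \in v0 :: vs -> p \in X v -> w (elt v p) = v.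
  move=> vin pX; have : elt v p \in cls v.
    by rewrite mem_nth // size_cls -cardX // cardE index_mem mem_enum.
  by rewrite mem_filter => /andP[/eqP].
pose col p := [seq elt v p | v <- v0 :: vs & p \in X v].
have size_col p : size (col p) = cap p by rewrite size_map size_filter countX.
have w_col p : map w (col p) = [seq v <- v0 :: vs | p \in X v].
  rewrite -map_comp -[RHS]map_id; apply/eq_in_map => v.
  by rewrite mem_filter => /andP[pX vin] /=; exact: w_elt.
have col_onto i : exists p, i \in col p.
  have i_cls : i \in cls (w i) by rewrite mem_filter eqxx mem_enum.
  have ltX : index i (cls (w i)) < size (enum (X (w i))).
    by rewrite -cardE cardX ?mem_vs // -size_cls index_mem.
  exists (nth (true, i0) (enum (X (w i))) (index i (cls (w i)))).
  apply/mapP; exists (w i).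
    by rewrite mem_filter mem_vs andbT -mem_enum mem_nth.
  by rewrite /elt index_uniq ?enum_uniq // nth_index.
pose cs b c := oapp (fun c' : 'I_n => col (b, c')) [::] (insub c).
have cs_ord b (c : 'I_n) : cs b c = col (b, c) by rewrite /cs valK.
have size_cs b c : size (cs b c) = count (ltn c) (if b then lm.1 else lm.2).
  rewrite /cs; case: insubP => [c' _ <- /=|]; first by rewrite size_col.
  rewrite -leqNgt => nc; apply/esym/eqP; rewrite -leqn0 leqNgt -has_count.
  apply/hasPn => p /(nthP 0)[j _ <-]; rewrite /= -leqNgt.
  by apply: leq_trans nc; case: b; exact: leq_trans (nth_le_sumn _ _) _.
have uniq_cs b c : uniq (map w (cs b c)).
  rewrite /cs; case: insubP => [c' _ _ /=|] //.
  by rewrite [X in uniq X]w_col filter_uniq.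
have [T [shapeT colT]] := tableau_of_columns i0 sorted1 (size_cs true).
have [S [shapeS colS]] := tableau_of_columns i0 sorted2 (size_cs false).
(* Every element is used and there are only [n] boxes, so each element is used exactly once. *)
have sub : {subset enum 'I_n <= flatten T ++ flatten S}.
  move=> i _; have [[b c] ic] := col_onto i; rewrite mem_cat.
  apply/orP; case: b ic => ic; [left|right]; apply/mem_flatten_column;
    by exists (val c); rewrite ?colT ?colS cs_ord.
have size_le : size (flatten T ++ flatten S) <= size (enum 'I_n).
  by rewrite size_cat !size_flatten shapeT shapeS sum_n size_enum_ord.
exists T, S; split.
- split=> //; rewrite perm_sym; apply: uniq_perm; rewrite ?enum_uniq //.
    exact: leq_size_uniq (enum_uniq _) sub size_le.
  by have [] := uniq_min_size (enum_uniq _) sub size_le.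
- by move=> c; rewrite colT.
- by move=> c; rewrite colS.
apply/allP => i /mem_flatten_column[c]; rewrite colS => ic.
move: ic; rewrite /cs; case: insubP => [c' _ _ /=|] //.
move=> /mapP[v]; rewrite mem_filter => /andP[cX vin] ->; rewrite w_elt //.
(* [XZ] confines the columns of [v0] to the first diagram. *)
apply: contraTneq cX => ->; apply/negP => /(fintype.subsetP XZ).
by rewrite inE.
Qed.

(** Both bounds come from [count_image_column] in each diagram. As [v0] is absent from [S],
    adjoining it to [s] costs one more row in the first diagram only. *)
Lemma admissible_bounds (n : nat) (V : eqType) (w : 'I_n -> V) (v0 : V)
    (lm : seq nat * seq nat) T S (s : seq V) k :
  let ys := [seq w i | i <- enum 'I_n] in
  BP n lm -> admissible w v0 lm T S -> size s <= k ->
  (count (mem s) ys <= \sum_(j < k) (nth 0 lm.1 j + nth 0 lm.2 j))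
  /\ (count (mem (v0 :: s)) ys
      <= \sum_(j < k) (nth 0 lm.1 j + nth 0 lm.2 j) + nth 0 lm.1 k).
Proof.
move=> ys [/andP[sorted1 _] /andP[sorted2 _] _].
case=> -[shapeT shapeS perm_TS] injT injS S0 sk.
have count_ys p : count p ys
    = count (fun i => p (w i)) (flatten T) + count (fun i => p (w i)) (flatten S).
  by rewrite count_map -count_cat (permP perm_TS).
have bT B j := @count_image_column _ _ w T B j.
have bS B j := @count_image_column _ _ w S B j.
rewrite shapeT in bT; rewrite shapeS in bS.
rewrite !count_ys big_split /=; split; first by rewrite leq_add ?bT ?bS.
rewrite addnAC -(big_ord_recr k (fun j => nth 0 lm.1 j)) leq_add ?bT //.
rewrite (@eq_in_count _ _ (fun i => w i \in s)) ?bS // => i iS /=.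
by rewrite inE (negPf (allP S0 i iS)).
Qed.

(** * Bidominance and multiplicities *)

(** The two components of the cut have j-th parts adding up to [nth 0 L j]. Both inequalities are
    now indexed by the same [k], which only adds the trivial case [k = 0] of the first one. *)
Lemma bidominated_cut L t lm : sorted geq L ->
  bidominated (cut L t) lm <->
  forall k, \sum_(j < k) nth 0 L j <= \sum_(j < k) (nth 0 lm.1 j + nth 0 lm.2 j)
    /\ \sum_(j < k) nth 0 L j + minn (nth 0 L k) t
       <= \sum_(j < k) (nth 0 lm.1 j + nth 0 lm.2 j) + nth 0 lm.1 k.
Proof.
move=> hL; have sum_cut k :
    \sum_(j < k) (nth 0 (cut L t).1 j + nth 0 (cut L t).2 j) = \sum_(j < k) nth 0 L j.
  by apply: eq_bigr => j _; have [-> ->] := cut_nth t j hL; lia.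
have cut1 k := (cut_nth t k hL).1.
split=> dom k; last by rewrite !sum_cut cut1; split; [have [] := dom k.+1|have [] := dom k].
have [_] := dom k; rewrite sum_cut cut1 => dom1; split=> //; case: k {dom1} => [|k].
  by rewrite !big_ord0.
by have [] := dom k; rewrite sum_cut.
Qed.

Lemma sum_nth_take k s : \sum_(j < k) nth 0 s j = sumn (take k s).
Proof.
elim: s k => [|x s IHs] [|k]; rewrite ?big_ord0 //=.
  by rewrite big1 // => j _; rewrite nth_nil.
by rewrite big_ord_recl /= IHs.
Qed.

Definition multiplicities (V : eqType) (ys : seq V) : seq nat :=
  sort geq [seq count_mem a ys | a <- undup ys].

Lemma geq_total : total geq.
Proof. by move=> x y; exact: leq_total. Qed.

Lemma multiplicities_sorted (V : eqType) (ys : seq V) : sorted geq (multiplicities ys).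
Proof. exact: sort_sorted geq_total _. Qed.

Lemma sumn_multiplicities (V : eqType) (ys : seq V) : sumn (multiplicities ys) = size ys.
Proof.
rewrite (perm_sumn (permEl (perm_sort _ _))) sumnE big_map sum_count_mem ?undup_uniq //.
by apply/eqP; rewrite -all_count; apply/allP => y /=; rewrite mem_undup.
Qed.

Lemma sum_count_le_top (V : eqType) (ys s : seq V) : uniq s ->
  \sum_(v <- s) count_mem v ys <= \sum_(j < size s) nth 0 (multiplicities ys) j.
Proof.
move=> us; pose s' := [seq v <- s | v \in ys].
have -> : \sum_(v <- s) count_mem v ys = sumn [seq count_mem v ys | v <- s'].
  rewrite sumnE big_map big_filter [RHS]big_mkcond; apply: eq_bigr => v _.
  by case: ifP => // /negbT/count_memPn.
have sub : subseq (sort geq [seq count_mem v ys | v <- s']) (multiplicities ys).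
  (* Listing the same values in the order of [undup ys] makes their counts a subsequence, which
     sorting preserves. *)
  pose t := [seq v <- undup ys | v \in s].
  rewrite (_ : sort _ _ = sort geq [seq count_mem v ys | v <- t]).
    apply: subseq_sort => [x y|x y z xy yz|]; first exact: geq_total.
      exact: leq_trans yz xy.
    exact/map_subseq/filter_subseq.
  apply/perm_sortP => [x y|x y z xy yz|x y|]; first exact: geq_total.
  - exact: leq_trans yz xy.
  - by move=> xy; apply/eqP; rewrite eqn_leq andbC.
  apply: perm_map; apply: uniq_perm; rewrite ?filter_uniq ?undup_uniq // => v.
  by rewrite !mem_filter mem_undup andbC.
rewrite -(perm_sumn (permEl (perm_sort geq _))).
apply: leq_trans (sumn_subseq_le (multiplicities_sorted ys) sub) _.
rewrite size_sort size_map; have le_s : size s' <= size s by rewrite size_filter count_size.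
rewrite -(subnKC le_s) big_split_ord; exact: leq_addr.
Qed.

Lemma bidominated_admissible (n : nat) (V : eqType) (w : 'I_n -> V) (v0 : V) lm :
  let ys := [seq w i | i <- enum 'I_n] in
  BP n lm ->
  bidominated (cut (multiplicities ys) (count_mem v0 ys)) lm <->
  exists T S, admissible w v0 lm T S.
Proof.
move=> ys lmBP; rewrite bidominated_cut; last exact: multiplicities_sorted.
set L := multiplicities ys; set t := count_mem v0 ys.
split=> [dom|[T [S adm]] k].
  apply: fill_bitableau => // s /[dup] uvs /andP[_ us].
    exact: leq_trans (sum_count_le_top ys us) (dom _).1.
  apply: leq_trans (dom _).2; rewrite addnC.
  (* The bound for [s] handles the case where the minimum is [t], the bound for [v0 :: s] the other
     one. *)
  have := sum_count_le_top ys us; have := sum_count_le_top ys uvs.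
  rewrite big_cons /= big_ord_recr /= -/ys -/L -/t; lia.
(* Values by decreasing frequency: the first [j] of them realise the [j] largest multiplicities. *)
pose U := sort (relpre (fun v => count_mem v ys) geq) (undup ys).
have uU : uniq U by rewrite sort_uniq undup_uniq.
have top j : \sum_(i < j) nth 0 L i = count (mem (take j U)) ys.
  rewrite sum_nth_take /L /multiplicities sort_map -map_take sumnE big_map.
  by rewrite sum_count_mem // take_uniq.
have size_top j : size (take j U) <= j by rewrite size_take_min geq_minl.
split; first by rewrite top; have [] := admissible_bounds lmBP adm (size_top k).
(* If [v0] is among the [k] most frequent values, the other values among the [k + 1] most frequent
   serve as [s], and the minimum is bounded by [nth 0 L k]. Otherwise [s] is the [k] most frequent
   values, and [v0] contributes [t]. *)
have [v0top|v0top] := boolP (v0 \in take k U).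
  have v0top' : v0 \in take k.+1 U.
    by move: v0top; rewrite -[take k U](take_takel U (leqnSn k)) => /mem_take.
  have size_rem : size (rem v0 (take k.+1 U)) <= k.
    by rewrite size_rem //; have := size_top k.+1; lia.
  have [_] := admissible_bounds lmBP adm size_rem; apply: leq_trans.
  apply: (@leq_trans (\sum_(j < k.+1) nth 0 L j)).
    by rewrite big_ord_recr leq_add2l geq_minl.
  rewrite top; apply: sub_count => v /=.
  by rewrite (perm_mem (perm_to_rem v0top')).
have [_] := admissible_bounds lmBP adm (size_top k); apply: leq_trans.
rewrite -sum_count_mem /= ?v0top ?take_uniq // big_cons sum_count_mem ?take_uniq //.
by rewrite -top addnC leq_add2r geq_minr.
Qed.

(** * Specht polynomials evaluated at a point *)

Section SpechtEvaluation.

Import GRing.Theory.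
Local Open Scope ring_scope.

Variables (n : nat) (K : fieldType).

Lemma Delta_neq0 (s : seq 'I_n) (y : 'I_n -> K) : (Delta s y != 0) = uniq (map y s).
Proof.
case: s => [|i0 s']; first by rewrite /Delta big_ord0 oner_eq0.
set s := i0 :: s'.
have nthE (i : 'I_(size s)) : y (tnth (in_tuple s) i) = nth 0 (map y s) i.
  by rewrite (tnth_nth i0) (nth_map i0).
apply/idP/(uniqP 0) => [/prodf_neq0 neq0|inj].
  have neq (i j : nat) : (i < j)%N -> (j < size s)%N -> nth 0 (map y s) i <> nth 0 (map y s) j.
    move=> ij js eq_ij; have is_ := ltn_trans ij js.
    have /prodf_neq0/(_ (Ordinal js) ij) := neq0 (Ordinal is_) isT.
    by rewrite !nthE /= eq_ij subrr eqxx.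
  move=> i j; rewrite !inE size_map => is_ js eq_ij.
  by case: (ltngtP i j) => // ij; have := neq _ _ ij; rewrite eq_ij; case.
apply/prodf_neq0 => i _; apply/prodf_neq0 => j ij.
rewrite subr_eq0 !nthE.
apply: contraTneq ij => /inj; rewrite !inE size_map => -> //.
by rewrite ltnn.
Qed.

Lemma meval_Delta (z : 'I_n -> K) (s : seq 'I_n) :
  (Delta s (fun k => 'X_k ^+ 2 : {mpoly K[n]})).@[z] = Delta s (fun k => z k ^+ 2).
Proof.
rewrite /Delta rmorph_prod; apply: eq_bigr => i _.
rewrite rmorph_prod; apply: eq_bigr => j _.
by rewrite rmorphB /= !rmorphXn /= !mevalXU.
Qed.

Lemma specht_neq0 (z : 'I_n -> K) (lm : seq nat * seq nat) (T S : seq (seq 'I_n)) :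
  BP n lm -> is_bitableau lm T S ->
  (specht K T S).@[z] != 0 <-> admissible (fun i => z i ^+ 2) 0 lm T S.
Proof.
case=> /andP[sorted1 _] /andP[sorted2 _] _ tab.
have [shapeT shapeS _] := tab.
have prodE T' : sorted geq (shape T') ->
    (\prod_(c < ncolumns T') Delta (column T' c) (fun k => z k ^+ 2) != 0)
    <-> column_injective (fun i => z i ^+ 2) T'.
  move=> hT'; split=> [/prodf_neq0 neq0 c|inj].
    (* [column_injective] ranges over all [c]; columns outside the product are empty. *)
    have [lt_c|le_c] := ltnP c (ncolumns T'); last by rewrite column_oversize.
    by rewrite -Delta_neq0; exact: (neq0 (Ordinal lt_c) isT).
  by apply/prodf_neq0 => c _; rewrite Delta_neq0.
have prodX : (\prod_(i <- flatten S) z i != 0) = all (fun i => z i ^+ 2 != 0) (flatten S).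
  by rewrite prodf_seq_neq0; apply: eq_all => i /=; rewrite expf_eq0.
rewrite /specht !rmorphM !rmorph_prod /=.
under eq_bigr => c _ do rewrite meval_Delta.
under [X in _ * X * _]eq_bigr => c _ do rewrite meval_Delta.
under [X in _ * _ * X]eq_bigr => i _ do rewrite mevalXU.
have := prodE T; have := prodE S; rewrite shapeT shapeS => /(_ sorted2) ES /(_ sorted1) ET.
rewrite !mulf_eq0 !negb_or prodX; split=> [/andP[/andP[/ET injT /ES injS] S0] //|].
by case=> _ /ET -> /ES -> ->.
Qed.

(** In a field a coordinate vanishes iff its square does, so the cut level is the multiplicity of 0
    among the squares. *)
Lemma OmegaE (z : 'rV[K]_n) :
  let ys := [seq z 0 i ^+ 2 | i <- enum 'I_n] in
  Omega z = cut (multiplicities ys) (count_mem 0 ys).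
Proof.
move=> ys; rewrite /Omega /orbit_type.
have -> : [seq map_mx (fun a => a ^+ 2) z 0 i | i <- enum 'I_n] = ys.
  by apply: eq_map => i; rewrite mxE.
congr cut; rewrite count_map cardsE cardE -size_filter; congr size.
by rewrite enumT; apply: eq_filter => i; rewrite !inE expf_eq0.
Qed.

Lemma Omega_BP (z : 'rV[K]_n) : BP n (Omega z).
Proof.
pose ys := [seq z 0 i ^+ 2 | i <- enum 'I_n].
have sum_n : sumn (multiplicities ys) = n.
  by rewrite sumn_multiplicities size_map size_enum_ord.
by rewrite OmegaE; have := cut_BP (count_mem 0 ys) (multiplicities_sorted ys); rewrite sum_n.
Qed.

Lemma specht_variety_bidominated (lm : seq nat * seq nat) (z : 'rV[K]_n) :
  BP n lm -> specht_variety n K lm z <-> ~ bidominated (Omega z) lm.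
Proof.
move=> lmBP; rewrite OmegaE (bidominated_admissible _ _ lmBP); split.
  move=> vanish [T [S adm]]; have [tab _ _ _] := adm.
  by move/(specht_neq0 (fun i => z 0 i) lmBP tab)/eqP: adm; apply; exact: vanish.
move=> noadm T S tab; apply/eqP/negPn/negP => neq0; apply: noadm.
by exists T, S; exact/(specht_neq0 _ lmBP tab).
Qed.

End SpechtEvaluation.

(** * Decomposition into orbit sets *)

Local Open Scope classical_set_scope.

Theorem theorem6 (K : fieldType) (charK0 : [pchar K]%R =i pred0) (n : nat)
    (lm : seq nat * seq nat) (lmBP : BP n lm) :
  specht_variety n K lm
    = ~` (\bigcup_(b in [set b | BP n b /\ bidominated b lm]) orbit_set n K b)
  /\ ~` (\bigcup_(b in [set b | BP n b /\ bidominated b lm]) orbit_set n K b)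
    = \bigcup_(b in [set b | BP n b /\ ~ bidominated b lm]) orbit_set n K b.
Proof.
(* Each [z] lies in the orbit set of [Omega z] and in no other, so every union becomes a condition
   on [Omega z]. *)
have compl : ~` (\bigcup_(b in [set b | BP n b /\ bidominated b lm]) orbit_set n K b)
    = [set z | ~ bidominated (Omega z) lm].
  apply/seteqP; split=> z /= ndom; last by case=> b [_ dom] zb; apply: ndom; rewrite zb.
  by move=> dom; apply: ndom; exists (Omega z) => //; split=> //; exact: Omega_BP.
rewrite compl; split; apply/seteqP; split=> z /=.
- by move/(specht_variety_bidominated _ lmBP).
- by move/(specht_variety_bidominated _ lmBP).
- by move=> ndom; exists (Omega z) => //; split=> //; exact: Omega_BP.
- by case=> b [_ ndom] zb; rewrite (zb : Omega z = b).
Qed.
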